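(* Let $H\leq F_m$ be a non-trivial finitely generated subgroup of the free group $F_m$ with basis $A=\{a_1,\dots,a_m\}$. Then the automaton $\mathcal{D}_H$ is a minimal DFA, i.e. no DFA with a smaller number of states than $\mathcal{D}_H$ recognizes the language $L(\mathcal{D}_H)$.
   Context: Automata. A finite automaton $\mathcal{A}=(Q,\Sigma,\delta,\mathcal{I},\mathcal{F})$ has a finite set of states $Q$, alphabet $\Sigma$, transition function $\delta:Q\times\Sigma\to 2^Q$, initial states $\mathcal{I}\subseteq Q$ and final states $\mathcal{F}\subseteq Q$. Its Moore diagram is the directed graph on $Q$ with an edge labelled $x$ from $q$ to $q'$ whenever $q'\in\delta(q,x)$. An admissible path is a directed path (possibly of length $0$) from an initial state to a final state; $L(\mathcal{A})$ is the set of labels of admissible paths. A DFA is a finite automaton with exactly one initial state and such that at each state the outgoing edges carry distinct labels; transitions may be undefined (i.e. $\delta(q,x)=\emptyset$ is allowed). Extended core. $\Sigma=A\cup A^{-1}$. A word over $\Sigma$ is reduced if it has no subword $xx^{-1}$, $x\in\Sigma$. The extended Schreier graph $\widehat\Gamma$ of $H$ is the directed labelled graph whose vertices are the right cosets $Hg$, $g\in F_m$, with exactly one edge labelled $x$ from $Hg$ to $Hgx$ for every vertex $Hg$ and every $x\in\Sigma$. The root is $v_0=H$. The extended core $\widehat\Delta_H=(\widehat V,\widehat E,\widehat\mu)$ is the subgraph of $\widehat\Gamma$ consisting of $v_0$ and all vertices and edges lying on closed paths based at $v_0$ whose label is a reduced word; it is finite when $H$ is finitely generated. $\widehat\mu(e)$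 and $t(e)$ are the label and terminus of an edge $e$. If $\widehat E$ contains an edge with origin $v$ and label $x$, its terminus is denoted $vx$. The automaton $\mathcal{D}_H$. It has alphabet $\Sigma$, states $Q_{\mathcal{D}_H}=\{q^*\}\cup\{(v,x)\mid v\in\widehat V,\ x\in\Sigma,\ \exists e\in\widehat E \text{ with } \widehat\mu(e)=x,\ t(e)=v\}$, unique initial state $q^*$, final states $\{q^*\}\cup\{(v_0,x)\mid (v_0,x)\in Q_{\mathcal{D}_H}\}$, and transitions $\delta(q^*,x)=(v_0x,x)$ whenever $\widehat E$ has an edge labelled $x$ with origin $v_0$, and $\delta((v,x),y)=(vy,y)$ whenever $y\neq x^{-1}$ and $\widehat E$ has an edge labelled $y$ with origin $v$; all other transitions are undefined. *)

(* Defs.v *)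
From HB Require Import structures.
From mathcomp Require Import all_boot finmap.
From mathcomp Require Import boolp classical_sets functions cardinality.

Set Implicit Arguments.
Unset Strict Implicit.
Unset Printing Implicit Defensive.

Local Open Scope classical_set_scope.
Local Open Scope group_scope.

(* The alphabet Sigma, the union of A and A^-1: (i, false) stands for a_i and
   (i, true) for a_i^-1. *)
Notation letter m := ('I_m * bool)%type.

Definition linv m (x : letter m) : letter m := (x.1, ~~ x.2).

Definition reduced m (w : seq (letter m)) : bool :=
  [forall x : letter m, ~~ infix [:: x; linv x] w].

Definition cons_letter m (x : letter m) (w : seq (letter m)) :=
  if w is y :: w' then if y == linv x then w' else x :: w else [:: x].

Definition reduce m (w : seq (letter m)) : seq (letter m) :=
  foldr (@cons_letter m) [::] w.

(* The free group F_m: reduced words, multiplied by concatenation followed by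
   free reduction. *)
Record freegroup (m : nat) :=
  FreeGroup { fword : seq (letter m); fwordP : reduced fword }.
HB.instance Definition _ m := [isSub for @fword m].
HB.instance Definition _ m := [Choice of freegroup m by <:].

Section FreeGroup.
Variable m : nat.
Implicit Types (x y : letter m) (u v w : seq (letter m)) (f g h : freegroup m).

Lemma linvK : involutive (@linv m).
Proof. by case=> i b; rewrite /linv /= negbK. Qed.

Lemma reduced_cons x w :
  reduced (x :: w) = (ohead w != Some (linv x)) && reduced w.
Proof.
apply/forallP/andP => [h|[hx /forallP h] y]; last first.
  rewrite infix_consl negb_or h andbT /= negb_and.
  case: eqVneq => //= ->; case: w hx {h} => [|z w] //= hx.
  by rewrite eq_sym prefix0s andbT; apply: contra hx => /eqP->.
split; last first.
  by apply/forallP => y; move: (h y); rewrite infix_consl negb_or => /andP[].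
move: (h x); rewrite infix_consl negb_or => /andP[+ _].
apply: contra; case: w {h} => [|z w] //= /eqP[->].
by rewrite !eqxx prefix0s.
Qed.

Lemma reduced_nil : reduced (Nil (letter m)).
Proof. by apply/forallP => x; rewrite infixs0. Qed.

Lemma reduced_cons_letter x w : reduced w -> reduced (cons_letter x w).
Proof.
case: w => [|y w] /=; first by rewrite reduced_cons.
case: eqVneq => [_|ne] h; first by move: h; rewrite reduced_cons => /andP[].
by rewrite reduced_cons h andbT /=; apply: contra ne => /eqP[->].
Qed.

Lemma reduced_foldr u w :
  reduced w -> reduced (foldr (@cons_letter m) w u).
Proof. by move=> rw; elim: u => //= x u; apply: reduced_cons_letter. Qed.

Lemma reduced_reduce w : reduced (reduce w).
Proof. exact: reduced_foldr reduced_nil. Qed.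

Lemma reduce_id w : reduced w -> reduce w = w.
Proof.
elim: w => //= x w IHw; rewrite reduced_cons => /andP[hx /IHw ->].
by case: w hx {IHw} => //= y w; case: (eqVneq y) => // ->; rewrite eqxx.
Qed.

Lemma cons_letterK x w :
  reduced w -> cons_letter x (cons_letter (linv x) w) = w.
Proof.
case: w => [|y w] /=; first by rewrite eqxx.
rewrite linvK; case: eqVneq => [->|_]; last by rewrite /= eqxx.
by case: w => [|z w] //=; rewrite reduced_cons /=; case: (eqVneq z) => // ->;
  rewrite eqxx.
Qed.

Lemma foldr_cons_letter u v w : reduced v -> reduced w ->
  foldr (@cons_letter m) w (foldr (@cons_letter m) v u)
  = foldr (@cons_letter m) (foldr (@cons_letter m) w v) u.
Proof.
move=> rv rw; elim: u => //= x u <-.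
case: (foldr _ v u) => //= y t; case: eqVneq => //= ->.
by rewrite cons_letterK // reduced_foldr.
Qed.

Definition freeone : freegroup m := FreeGroup reduced_nil.

Definition freemul f g : freegroup m :=
  FreeGroup (reduced_reduce (fword f ++ fword g)).

Definition freeinv f : freegroup m :=
  FreeGroup (reduced_reduce (rev (map (@linv m) (fword f)))).

Lemma fword_mul f g :
  fword (freemul f g) = foldr (@cons_letter m) (fword g) (fword f).
Proof.
by rewrite /= /reduce foldr_cat -/(reduce (fword g)) reduce_id // fwordP.
Qed.

Lemma fmulA : associative freemul.
Proof.
move=> f g h; apply: val_inj; rewrite [LHS]fword_mul [RHS]fword_mul !fword_mul.
by rewrite foldr_cons_letter // fwordP.
Qed.

Lemma fmul1 : left_id freeone freemul.
Proof. by move=> f; apply: val_inj; rewrite [LHS]fword_mul. Qed.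

Lemma fmulr1 : right_id freeone freemul.
Proof.
by move=> f; apply: val_inj; rewrite /= cats0 reduce_id // fwordP.
Qed.

Lemma reduce_rev_inv w : reduce (w ++ rev (map (@linv m) w)) = [::].
Proof.
elim: w => //= x w IHw; rewrite rev_cons -cats1 catA.
rewrite /reduce foldr_cat /=.
have r1 : reduced [:: linv x] by rewrite reduced_cons reduced_nil.
have /= := foldr_cons_letter (w ++ rev (map (@linv m) w)) reduced_nil r1.
by rewrite -/(reduce (w ++ _)) IHw /= => <- /=; rewrite eqxx.
Qed.

Lemma reduced_inv w : reduced w -> reduced (rev (map (@linv m) w)).
Proof.
move=> /forallP h; apply/forallP => x; apply: contra (h x).
move=> /(@infixP _ _ _)[s1 [s2 /(congr1 (fun s => map (@linv m) (rev s)))]].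
rewrite revK -map_comp (eq_map linvK) map_id => ->.
rewrite !rev_cat map_cat /= map_cat /= linvK -catA.
apply/infixP; eexists; eexists; reflexivity.
Qed.

Lemma fmulV : right_inverse freeone freeinv freemul.
Proof.
move=> f; apply: val_inj.
by rewrite /= (reduce_id (reduced_inv (fwordP f))) reduce_rev_inv.
Qed.

Lemma fmulVl : left_inverse freeone freeinv freemul.
Proof.
move=> f; apply: val_inj => /=; rewrite (reduce_id (reduced_inv (fwordP f))).
have := reduce_rev_inv (rev (map (@linv m) (fword f))).
by rewrite map_rev revK -map_comp (eq_map linvK) map_id.
Qed.

HB.instance Definition _ :=
  isGroup.Build (freegroup m) fmulA fmul1 fmulr1 fmulVl fmulV.

End FreeGroup.

Lemma reduced_letter m (x : letter m) : reduced [:: x].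
Proof. by rewrite reduced_cons reduced_nil. Qed.

Definition fletter m (x : letter m) : freegroup m :=
  FreeGroup (reduced_letter x).

Definition is_subgroup (G : groupType) (H : set G) : Prop :=
  group_closed (mem H).

Definition finitely_generated (G : groupType) (H : set G) : Prop :=
  exists2 S : set G, finite_set S & H = smallest (@is_subgroup G) S.

Definition right_coset (G : groupType) (H : set G) (g : G) : set G :=
  [set h * g | h in H].

(* Directed labelled graphs with edge set E : set (V * X * V), an edge being a
   triple (origin, label, terminus). *)
Section Digraph.
Variables (V X : Type).
Implicit Types (E : set (V * X * V)) (e : V * X * V).

Definition origin e : V := e.1.1.
Definition label e : X := e.1.2.
Definition terminus e : V := e.2.

Fixpoint dpath E (v : V) (p : seq (V * X * V)) (v' : V) : Prop :=
  if p is e :: p' then [/\ E e, origin e = v & dpath E (terminus e) p' v']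
  else v = v'.

End Digraph.

Record automaton (X : Type) := Automaton {
  state : choiceType;
  trans : state -> X -> set state;
  initial : set state;
  final : set state
}.
Arguments trans {X} M q x _ : rename.
Arguments initial {X} M _ : rename.
Arguments final {X} M _ : rename.

Section Automata.
Variable X : Type.
Implicit Types M N : automaton X.

Definition moore_diagram M : set (state M * X * state M) :=
  [set e | trans M (origin e) (label e) (terminus e)].
Arguments moore_diagram M _ : clear implicits.

Definition language M : set (seq X) :=
  [set w | exists q p q', [/\ initial M q, final M q',
     dpath (moore_diagram M) q p q' & w = map (@label _ _) p]].

Definition is_dfa M : Prop :=
  [/\ finite_set [set: state M],
      exists q0 : state M, initial M = [set q0] &
      forall e e', moore_diagram M e -> moore_diagram M e' ->
        origin e = origin e' -> label e = label e' -> e = e'].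

Definition nstates M : nat := #|` fset_set [set: state M]|.

Definition is_minimal_dfa M : Prop :=
  is_dfa M /\
  ~ exists N, [/\ is_dfa N, language N = language M & (nstates N < nstates M)%N].

End Automata.

Section ExtendedCore.
Variables (m : nat) (H : set (freegroup m)).

Notation vertex := (set (freegroup m)).
Notation edge := (vertex * letter m * vertex)%type.

Definition schreier_edges : set edge :=
  [set e | exists g, origin e = right_coset H g /\
                     terminus e = right_coset H (g * fletter (label e))].

(* The root v_0 is the coset H itself. *)
Definition core_root : vertex := H.

Definition reduced_closed_path (p : seq edge) : Prop :=
  dpath schreier_edges core_root p core_root /\ reduced (map (@label _ _) p).

Definition core_vertices : set vertex :=
  core_root |` [set v | exists p e, [/\ reduced_closed_path p, e \in p &
                                   v = origin e \/ v = terminus e]].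

Definition core_edges : set edge :=
  [set e | exists2 p, reduced_closed_path p & e \in p].

Definition D_pairs : set (vertex * letter m) :=
  [set vx | core_vertices vx.1 /\
            exists e, [/\ core_edges e, label e = vx.2 & terminus e = vx.1]].

(* None is the state q*. *)
Definition D_state : choiceType := option D_pairs.

Definition D_trans (q : D_state) (y : letter m) : set D_state :=
  [set q' | match q, q' with
            | None, Some r' =>
                core_edges (core_root, y, (val r').1) /\ (val r').2 = y
            | Some r, Some r' =>
                [/\ y <> linv (val r).2,
                    core_edges ((val r).1, y, (val r').1) & (val r').2 = y]
            | _, None => False
            end].

Definition D_final : set D_state :=
  [set q | if q is Some r then (val r).1 = core_root else True].

Definition D_automaton : automaton (letter m) :=
  Automaton D_trans [set None] D_final.

End ExtendedCore.

(* Main.v *)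
Require Import Defs.
From mathcomp Require Import all_boot finmap.
From mathcomp Require Import boolp classical_sets cardinality.

(* A DFA whose states are accessible, co-accessible and have pairwise distinct
   right languages is minimal.  Any word accepted from (v, x) labels a path of
   the Schreier graph from v to the root, and the Schreier graph is both
   deterministic and co-deterministic, so right languages tell vertices apart.
   Two states at the same vertex v are told apart by a word starting with x^-1,
   which is never accepted from (v, x): the inverse of a core edge entering v
   with label x is again a core edge, so such a word is accepted from every
   other state at v.
   The core is finite because the elements of H whose reduced word only visits
   vertices visited by the generators form a subgroup. *)

Local Open Scope classical_set_scope.
Local Open Scope group_scope.

(** * Paths in labelled digraphs *)

Section DirectedPaths.
Variables (V X : Type).
Implicit Types (E : set (V * X * V)) (p : seq (V * X * V)).

Lemma dpath_cat E v p1 p2 v' :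
  dpath E v (p1 ++ p2) v' <-> exists2 u, dpath E v p1 u & dpath E u p2 v'.
Proof.
elim: p1 v => [|e p1 IHp] v /=.
  by split=> [pth|[_ <-] //]; exists v.
split=> [[Ee oe /IHp[u pth1 pth2]]|[u [Ee oe pth1] pth2]]; first by exists u.
by split=> //; apply/IHp; exists u.
Qed.

End DirectedPaths.

Lemma dpath_sub_in (V X : eqType) (E E' : set (V * X * V)) v p v' :
  (forall e, e \in p -> E' e) -> dpath E v p v' -> dpath E' v p v'.
Proof.
elim: p v => [|e p IHp] v //= sub [_ oe pth].
split=> //; first by apply: sub; rewrite mem_head.
by apply: IHp => // f fp; apply: sub; rewrite inE fp orbT.
Qed.

(** * Right languages and a minimality criterion *)

Section RightLanguages.
Variable X : Type.
Implicit Types (M N : automaton X) (w : seq X).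

Definition reach M (q : state M) w (q' : state M) : Prop :=
  exists2 p, dpath (@moore_diagram X M) q p q' & w = map (@label _ _) p.

Definition right_language M (q : state M) : set (seq X) :=
  [set w | exists2 q', reach M q w q' & final M q'].

Lemma reach_nil M q q' : reach M q [::] q' <-> q = q'.
Proof. by split=> [[[|e p] //=]|<-]; exists [::]. Qed.

Lemma reach_cons M q x w q' :
  reach M q (x :: w) q' <-> exists2 r, trans M q x r & reach M r w q'.
Proof.
split=> [[[|[[o y] r] p] //= [Ee <- pth] [-> ->]]|[r qr [p pth ->]]].
  by exists r => //; exists p.
by exists ((q, x, r) :: p).
Qed.

Lemma reach_cat M q w1 w2 q' :
  reach M q (w1 ++ w2) q' <-> exists2 r, reach M q w1 r & reach M r w2 q'.
Proof.
elim: w1 q => [|x w1 IHw] q /=.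
  by split=> [qq'|[r /reach_nil<-]//]; exists q => //; apply/reach_nil.
split=> [/reach_cons[r qr /IHw[s rs sq']]|[s /reach_cons[r qr rs] sq']].
  by exists s => //; apply/reach_cons; exists r.
by apply/reach_cons; exists r => //; apply/IHw; exists s.
Qed.

Lemma language_right M q0 :
  initial M = [set q0] -> language M = right_language M q0.
Proof.
move=> init; apply/seteqP; split=> w.
  rewrite /language init => -[_ [p [q' [-> fq' pth ->]]]].
  by exists q' => //; exists p.
by move=> [q' [p pth ->] fq']; exists q0, p, q'; rewrite init.
Qed.

Lemma reach_det M q w q1 q2 :
  is_dfa M -> reach M q w q1 -> reach M q w q2 -> q1 = q2.
Proof.
move=> [_ _ det]; elim: w q => [|x w IHw] q.
  by move=> /reach_nil eq1 /reach_nil eq2; rewrite -eq1 -eq2.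
move=> /reach_cons[r1 qr1 rq1] /reach_cons[r2 qr2 rq2].
have [r12] := det (q, x, r1) (q, x, r2) qr1 qr2 erefl erefl.
by apply: IHw rq1 _; rewrite r12.
Qed.

(** By determinism every run on [w ++ w'] from [q] passes through [r]. Right languages are thus left
    quotients, which can be compared across two automata. *)
Lemma right_language_cat M q w r :
  is_dfa M -> reach M q w r ->
  right_language M r = [set w' | right_language M q (w ++ w')].
Proof.
move=> dfaM qr; apply/seteqP; split=> w' [q' rq' fq']; exists q' => //.
  by apply/reach_cat; exists r.
by have [s /(reach_det _ _ _ _ _ dfaM qr)->] := (reach_cat _ _ _ _ _).1 rq'.
Qed.

(* The Myhill-Nerode criterion: each state of M is sent to a state of N with
   the same right language. *)
Lemma minimal_dfa_criterion M q0 :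
  is_dfa M -> initial M = [set q0] ->
  (forall q, exists w, reach M q0 w q) ->
  (forall q, right_language M q !=set0) ->
  injective (right_language M) ->
  is_minimal_dfa M.
Proof.
move=> dfaM init acc coacc inj; split=> // -[N [dfaN eqL]].
have [finN [n0 initN] _] := dfaN; have [finM _ _] := dfaM.
move: eqL; rewrite (language_right _ _ init) (language_right _ _ initN) => eqL.
have /choice[f fP] q : exists t, right_language N t = right_language M q.
  have [w q0q] := acc q; have [w' qw'] := coacc q.
  (* A run of [N] on [w] is obtained by completing [w] to a word of the common language. *)
  have : right_language N n0 (w ++ w').
    by rewrite eqL; move: qw'; rewrite (right_language_cat _ _ _ _ dfaM q0q).
  move=> [t' /reach_cat[t n0t _] _]; exists t.
  by rewrite (right_language_cat _ _ _ _ dfaM q0q)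
             (right_language_cat _ _ _ _ dfaN n0t) eqL.
have f_inj : injective f by move=> q q' eqf; apply: inj; rewrite -!fP eqf.
apply/negP; rewrite -leqNgt /nstates.
rewrite -(card_imfset imfset_key (mem (fset_set [set: state M])) f_inj) /=.
by apply/fsubset_leq_card/fsubsetP => t _; rewrite in_fset_set ?in_setT.
Qed.

End RightLanguages.

(** * Words evaluated in the free group *)

Section FreeWords.
Variable m : nat.
Implicit Types (x : letter m) (w : seq (letter m)).

(** The projection of the free monoid onto [freegroup m]; path labels need not be reduced. *)
Definition freeword w : freegroup m := FreeGroup (reduced_reduce w).

Lemma freeword_cons x w : freeword (x :: w) = fletter x * freeword w.
Proof. by apply: val_inj; rewrite [RHS]fword_mul. Qed.

Lemma freeword_nil : freeword [::] = 1.
Proof. exact: val_inj. Qed.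

Lemma freeword_fword (g : freegroup m) : freeword (fword g) = g.
Proof. by apply: val_inj; rewrite /= reduce_id // fwordP. Qed.

Lemma freeword_cat w1 w2 : freeword (w1 ++ w2) = freeword w1 * freeword w2.
Proof.
elim: w1 => [|x w1 IHw] /=; first by rewrite freeword_nil mul1g.
by rewrite !freeword_cons IHw mulgA.
Qed.

Lemma freeword_inv w : freeword (rev (map (@linv m) w)) = (freeword w)^-1.
Proof.
apply: (mulgI (freeword w)); rewrite mulgV -freeword_cat.
by apply: val_inj; rewrite /= reduce_rev_inv.
Qed.

Lemma fletterV x : fletter x * fletter (linv x) = 1.
Proof. by apply: val_inj; rewrite [LHS]fword_mul /= eqxx. Qed.

End FreeWords.

(** * Right translates of a subgroup *)

Section Cosets.
Variables (G : groupType) (H : set G).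
Hypothesis Hgrp : is_subgroup H.

Lemma subgroup1 : H 1.
Proof. by have [] := Hgrp; rewrite in_setE. Qed.

Lemma subgroup_div g h : H g -> H h -> H (g / h).
Proof. by case: Hgrp => _ div Hg Hh; have := div g h; rewrite !in_setE; apply. Qed.

Lemma subgroup_inv h : H h -> H h^-1.
Proof.
by move=> Hh; rewrite -[_^-1]mul1g; apply: subgroup_div => //; exact: subgroup1.
Qed.

Lemma subgroup_mul g h : H g -> H h -> H (g * h).
Proof. by move=> Hg Hh; rewrite -[h]invgK; apply/subgroup_div/subgroup_inv. Qed.

Lemma right_coset1 (v : set G) : right_coset v 1 = v.
Proof.
apply/seteqP; split=> [_ [h vh <-]|h vh]; first by rewrite mulg1.
by exists h; rewrite ?mulg1.
Qed.

Lemma right_cosetM (v : set G) g k :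
  right_coset (right_coset v g) k = right_coset v (g * k).
Proof.
apply/seteqP; split=> [_ [_ [h vh <-] <-]|_ [h vh <-]].
  by exists h; rewrite ?mulgA.
by exists (h * g); rewrite ?mulgA //; exists h.
Qed.

Lemma right_coset_id h : right_coset H h = H <-> H h.
Proof.
split=> [<-|Hh]; first by exists 1; rewrite ?mul1g //; exact: subgroup1.
apply/seteqP; split=> [_ [g Hg <-]|g Hg]; first exact: subgroup_mul.
by exists (g * h^-1); rewrite ?mulgVK //; apply: subgroup_div.
Qed.

(** Translation by [g] is invertible. Applied to path labels, this is the co-determinism of the
    Schreier graph. *)
Lemma right_coset_inj (v v' : set G) g :
  right_coset v g = right_coset v' g -> v = v'.
Proof.
move=> /(congr1 (fun u => right_coset u g^-1)).
by rewrite !right_cosetM mulgV !right_coset1.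
Qed.

End Cosets.

(** * The Schreier graph and its core *)

Section SchreierGraph.
Variables (m : nat) (H : set (freegroup m)).
Hypothesis Hgrp : is_subgroup H.

Notation vertex := (set (freegroup m)).
Notation edge := (vertex * letter m * vertex)%type.
Implicit Types (e : edge) (p : seq edge) (v : vertex) (x : letter m)
  (w : seq (letter m)).

(** The representative [g] drops out because vertices are translated as sets; this is determinism of
    the graph. *)
Lemma schreier_terminus e :
  schreier_edges H e -> terminus e = right_coset (origin e) (fletter (label e)).
Proof. by move=> [g [-> ->]]; rewrite right_cosetM. Qed.

Lemma schreier_path v p v' : dpath (schreier_edges H) v p v' ->
  v' = right_coset v (freeword _ (map (@label _ _) p)).
Proof.
elim: p v => [|e p IHp] v /=; first by move=> <-; rewrite freeword_nil right_coset1.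
move=> [Ee <- /IHp->].
by rewrite freeword_cons -right_cosetM -schreier_terminus.
Qed.

Definition einv e : edge := (terminus e, linv (label e), origin e).

Lemma schreier_einv e : schreier_edges H e -> schreier_edges H (einv e).
Proof.
move=> [g [oe te]]; exists (g * fletter (label e)); split=> //=.
by rewrite -mulgA fletterV mulg1.
Qed.

Lemma schreier_path_inv v p v' : dpath (schreier_edges H) v p v' ->
  dpath (schreier_edges H) v' (rev (map einv p)) v.
Proof.
elim: p v => [|e p IHp] v //= [Ee <- /IHp pth].
rewrite rev_cons -cats1; apply/dpath_cat; exists (terminus e) => //=.
by split=> //; exact: schreier_einv.
Qed.

(** Inverting a word creates no cancelling pair, and Schreier edges can be traversed backwards.
    Hence the core is closed under [einv]. *)
Lemma reduced_closed_path_inv p :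
  reduced_closed_path H p -> reduced_closed_path H (rev (map einv p)).
Proof.
move=> [pth red]; split; first exact: schreier_path_inv.
rewrite map_rev -map_comp; have := reduced_inv red.
by rewrite -map_comp.
Qed.

Lemma core_einv e : core_edges H e -> core_edges H (einv e).
Proof.
move=> [p rp ep]; exists (rev (map einv p)); first exact: reduced_closed_path_inv.
by rewrite mem_rev; apply: map_f.
Qed.

Lemma core_schreier e : core_edges H e -> schreier_edges H e.
Proof.
move=> [p [pth _] ep]; have [p1 [p2 eqp]] : exists p1 p2, p = p1 ++ e :: p2.
  by case/splitPr: ep => p1 p2; exists p1, p2.
by move: pth; rewrite eqp => /dpath_cat[u _ []].
Qed.

(** Cut a reduced closed path at [e]; both pieces stay in the core, as all their edges lie on that
    same path. *)
Lemma core_edgeP e : core_edges H e ->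
  exists p1 p2, [/\ dpath (core_edges H) (core_root H) p1 (origin e),
    dpath (core_edges H) (terminus e) p2 (core_root H) &
    reduced (map (@label _ _) (p1 ++ e :: p2))].
Proof.
move=> [p rp ep]; have [pth red] := rp.
have {pth} : dpath (core_edges H) (core_root H) p (core_root H).
  by apply: dpath_sub_in pth => f fp; exists p.
move: red; case/splitPr: ep => p1 p2 red /dpath_cat[u pth1 [_ oe pth2]].
by exists p1, p2; rewrite oe.
Qed.

(** * Finiteness of the core *)

Fixpoint visits_in (P : set vertex) v w : Prop :=
  P v /\
  if w is x :: w' then visits_in P (right_coset v (fletter x)) w' else True.

Lemma visits_in_start P v w : visits_in P v w -> P v.
Proof. by case: w => [|x w] []. Qed.

Lemma visits_in_cat P v w1 w2 : visits_in P v (w1 ++ w2) <->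
  visits_in P v w1 /\ visits_in P (right_coset v (freeword _ w1)) w2.
Proof.
elim: w1 v => [|x w1 IHw] v /=.
  rewrite freeword_nil right_coset1.
  by split=> [vw2|[]//]; split=> //; split=> //; apply: visits_in_start vw2.
rewrite freeword_cons -right_cosetM; split=> [[Pv /IHw[]]|[[Pv v1] v2]] //.
by split=> //; apply/IHw.
Qed.

(* Free reduction only removes backtracking, hence no new vertex is visited. *)
Lemma visits_in_reduce P v w : visits_in P v w -> visits_in P v (reduce w).
Proof.
elim: w v => [|x w IHw] v //= [Pv /IHw]; case: (reduce w) => [|y w'] //=.
case: eqVneq => [->|_] //= [_]; by rewrite right_cosetM fletterV right_coset1.
Qed.

(** The inverse word retraces the same vertices in the opposite order. *)
Lemma visits_in_inv P v w : visits_in P v w ->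
  visits_in P (right_coset v (freeword _ w)) (rev (map (@linv m) w)).
Proof.
elim: w v => [|x w IHw] v /=; first by rewrite freeword_nil right_coset1.
move=> [Pv vw]; rewrite rev_cons -cats1 freeword_cons -right_cosetM.
apply/visits_in_cat; split; first exact: IHw.
rewrite freeword_inv /= !right_cosetM mulgV mulg1 fletterV right_coset1; split=> //.
exact: visits_in_start vw.
Qed.

Lemma visits_in_path P v p v' e : dpath (schreier_edges H) v p v' ->
  visits_in P v (map (@label _ _) p) -> e \in p -> P (origin e) /\ P (terminus e).
Proof.
elim: p v => [|f p IHp] v //= [Ef <- pth] [Pv]; rewrite -schreier_terminus // => vp.
rewrite inE => /predU1P[->|]; last exact: IHp pth vp.
by split=> //; apply: visits_in_start vp.
Qed.

(** The vertices met when the reduced words of the generators are read from the root. [H] is added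
    so that the root is present even if [S] is empty. *)
Definition generator_vertices (S : set (freegroup m)) : set vertex :=
  H |` \bigcup_(s in S) [set right_coset H (freeword _ (take i (fword s))) |
                         i in `I_(size (fword s)).+1].

Lemma finite_generator_vertices S :
  finite_set S -> finite_set (generator_vertices S).
Proof.
move=> finS; rewrite finite_setU; split; first exact: finite_set1.
by apply: bigcup_finite => // s _; apply/finite_image/finite_II.
Qed.

Lemma visits_in_prefixes P v w :
  (forall i, (i <= size w)%N -> P (right_coset v (freeword _ (take i w)))) ->
  visits_in P v w.
Proof.
elim: w v => [|x w IHw] v Pw /=.
  by split=> //; have := Pw 0 erefl; rewrite freeword_nil right_coset1.
split; first by have := Pw 0 erefl; rewrite take0 freeword_nil right_coset1.
by apply: IHw => i lei; have := Pw i.+1 lei; rewrite /= freeword_cons right_cosetM.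
Qed.

Lemma core_edges_generator_vertices S e :
  H = smallest (@is_subgroup _) S -> core_edges H e ->
  generator_vertices S (origin e) /\ generator_vertices S (terminus e).
Proof.
set P := generator_vertices S => HS [p [pth red] ep].
(* Once [K] is a subgroup containing [S], minimality of [H] puts every element of [H] into [K]. *)
pose K := [set h | H h /\ visits_in P H (fword h)].
have Kgrp : is_subgroup K.
  split=> [|h k]; rewrite !in_setE.
    by split; [exact: subgroup1 | split=> //; left].
  move=> [Hh vh] [Hk vk]; split; first exact: subgroup_div.
  (* The word of [h] leads back to the root; from there the inverse word of [k] retraces the loop of
     [k]. *)
  rewrite /=; apply/visits_in_reduce/visits_in_cat; split=> //.
  rewrite freeword_fword ((right_coset_id _ _ Hgrp h).2 Hh).
  apply: visits_in_reduce; have := visits_in_inv _ _ _ vk.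
  by rewrite freeword_fword ((right_coset_id _ _ Hgrp k).2 Hk).
have SK : S `<=` K.
  move=> s Ss; split; first by rewrite HS; apply: sub_gen_smallest.
  by apply: visits_in_prefixes => i lei; right; exists s => //; exists i.
(* The path closes at the root, so its label represents an element of [H]; being reduced, the label
   is the [fword] of that element. *)
have : H (freeword _ (map (@label _ _) p)).
  by apply/right_coset_id => //; rewrite -(schreier_path _ _ _ pth).
rewrite {1}HS => /(smallest_sub Kgrp SK)[_].
by rewrite /= reduce_id // => vp; apply: visits_in_path pth vp ep.
Qed.

End SchreierGraph.

(** * Runs of the automaton as core paths *)

Section DAutomaton.
Variables (m : nat) (H : set (freegroup m)).
Hypothesis Hgrp : is_subgroup H.

Notation vertex := (set (freegroup m)).
Notation edge := (vertex * letter m * vertex)%type.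
Notation D := (D_automaton H).
Implicit Types (e : edge) (p : seq edge) (q : state D) (w : seq (letter m)).

(* The state q^* behaves like a visit of the root with no last letter. *)
Definition D_position q : vertex * option (letter m) :=
  if q is Some r then ((val r).1, Some (val r).2) else (core_root H, None).

Lemma D_position_inj : injective D_position.
Proof.
case=> [r|] [s|] //= [eq1 eq2]; congr Some; apply: val_inj.
by rewrite [LHS]surjective_pairing eq1 eq2 -surjective_pairing.
Qed.

Definition position_step (vo : vertex * option (letter m)) e :=
  (terminus e, Some (label e)).

Lemma position_step_vertex E v o p v' :
  dpath E v p v' -> (foldl position_step (v, o) p).1 = v'.
Proof. by elim: p v o => [|e p IHp] v o //= [_ _ pth]; apply: IHp. Qed.

Lemma core_edge_pair e : core_edges H e -> D_pairs H (terminus e, label e).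
Proof.
move=> Ee; split; last by exists e.
by case: Ee => p rp ep; right; exists p, e; split=> //; right.
Qed.

(** Along core edges the automaton only forbids cancelling the last letter. Prepending the letter
    stored in [q] makes reducedness cover the first transition too. *)
Lemma D_run q p v' :
  dpath (core_edges H) (D_position q).1 p v' ->
  reduced (seq_of_opt (D_position q).2 ++ map (@label _ _) p) ->
  exists2 q', reach _ D q (map (@label _ _) p) q' &
    D_position q' = foldl position_step (D_position q) p.
Proof.
elim: p q => [|e p IHp] q; first by move=> _ _; exists q => //; apply/reach_nil.
move=> /= [Ee oe pth] red.
pose r : D_pairs H := SigSub (mem_set (core_edge_pair _ Ee)).
have qr : D_trans q (label e) (Some r).
  have Ee' : core_edges H ((D_position q).1, label e, terminus e).
    by rewrite -oe; case: e Ee {IHp oe pth red r} => -[].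
  case: q Ee' red {IHp oe} => [s|] //= Ee'.
  rewrite reduced_cons /= => /andP[/eqP ne _]; split=> //.
  by move=> eqy; apply: ne; rewrite eqy.
have redr : reduced (label e :: map (@label _ _) p).
  case: (D_position q).2 red => [y|] //=.
  by rewrite reduced_cons => /andP[].
have [q' rq' pos] := IHp (Some r) pth redr.
by exists q' => //; apply/reach_cons; exists (Some r).
Qed.

(** Dropping the stored letters turns a run into a Schreier path with the same label. *)
Lemma D_reach_vertex q w q' : reach _ D q w q' ->
  (D_position q').1 = right_coset (D_position q).1 (freeword _ w).
Proof.
elim: w q => [|x w IHw] q.
  by move=> /reach_nil<-; rewrite freeword_nil right_coset1.
move=> /reach_cons[r qr /IHw->]; rewrite freeword_cons -right_cosetM.
congr right_coset; case: q r qr => [s|] [r|] //=.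
  by move=> [_ /core_schreier/schreier_terminus].
by move=> [/core_schreier/schreier_terminus].
Qed.

Lemma D_final_vertex q : final D q <-> (D_position q).1 = H.
Proof. by case: q. Qed.

Lemma D_right_vertex q w :
  right_language _ D q w -> right_coset (D_position q).1 (freeword _ w) = H.
Proof. by move=> [q' /D_reach_vertex<- /D_final_vertex]. Qed.

Lemma D_right_run q p :
  dpath (core_edges H) (D_position q).1 p H ->
  reduced (seq_of_opt (D_position q).2 ++ map (@label _ _) p) ->
  right_language _ D q (map (@label _ _) p).
Proof.
move=> pth red; have [q' qq' pos] := D_run _ _ _ pth red.
exists q' => //; apply/D_final_vertex; rewrite pos.
by case: (D_position q) pth => v o; apply: position_step_vertex.
Qed.

Lemma reduced_catr (w1 w2 : seq (letter m)) : reduced (w1 ++ w2) -> reduced w2.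
Proof. by elim: w1 => //= x w1 IHw; rewrite reduced_cons => /andP[_ /IHw]. Qed.

(** The edge continues to the root along a reduced closed path; the condition on the stored letter
    keeps the first transition allowed. *)
Lemma D_right_edge q e : core_edges H e -> origin e = (D_position q).1 ->
  (D_position q).2 <> Some (linv (label e)) ->
  exists w, right_language _ D q (label e :: w).
Proof.
move=> Ee oe ne; have [p1 [p2 [_ pth2 red]]] := core_edgeP _ _ _ Ee.
exists (map (@label _ _) p2); apply: (D_right_run _ (e :: p2)); first by split.
move: red; rewrite map_cat => /reduced_catr red.
case: (D_position q).2 ne => [x|] //= ne.
rewrite reduced_cons red andbT /=; apply/eqP => -[eqx].
by apply: ne; rewrite eqx linvK.
Qed.

(** * Separation of states by right languages *)

Lemma D_right_excluded (r : D_pairs H) w :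
  ~ right_language _ D (Some r) (linv (val r).2 :: w).
Proof. by move=> [q' /reach_cons[[s|] //= [ne _ _]]]. Qed.

(** Some core edge enters the vertex with the letter of [r]. Its reverse leaves that vertex and is
    forbidden only right after this letter. *)
Lemma D_right_other q (r : D_pairs H) :
  (D_position q).1 = (val r).1 -> (D_position q).2 <> Some (val r).2 ->
  exists w, right_language _ D q (linv (val r).2 :: w).
Proof.
move=> eqv ne; have [_ [e [Ee le te]]] := set_valP r.
rewrite -le; apply: (D_right_edge q (einv _ e)); first exact: core_einv.
  by rewrite eqv.
by rewrite /= linvK le.
Qed.

Lemma D_right_nonempty q : right_language _ D q !=set0.
Proof.
case: q => [r|]; last by exists [::], None => //; apply/reach_nil.
have [_ [e [Ee le te]]] := set_valP r.
have [p1 [p2 [_ pth2 red]]] := core_edgeP _ _ _ Ee.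
exists (map (@label _ _) p2); apply: D_right_run; first by rewrite /= -te.
by move: red; rewrite map_cat => /reduced_catr; rewrite /= -le.
Qed.

Lemma D_right_inj : injective (right_language _ D).
Proof.
move=> q q' eqR.
have eqv : (D_position q).1 = (D_position q').1.
  (* A word accepted from both states translates both vertices to [H]; the translation can be
     undone. *)
  have [w qw] := D_right_nonempty q; have q'w := qw; rewrite eqR in q'w.
  apply: (right_coset_inj _ _ _ (freeword _ w)).
  by rewrite (D_right_vertex _ _ qw) (D_right_vertex _ _ q'w).
(* Distinct states at one vertex differ in the stored letter, so a word starting with the inverse of
   the letter of [r] separates them. *)
have agree q1 q2 : right_language _ D q1 = right_language _ D q2 ->
    (D_position q1).1 = (D_position q2).1 ->
  forall r, q2 = Some r -> q1 = q2.
  move=> eq12 eqv12 r eqr; apply: contrapT => ne.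
  have [||w] := D_right_other q1 r; first by rewrite eqv12 eqr.
    move=> eqo; apply/ne/D_position_inj.
    by rewrite [LHS]surjective_pairing eqv12 eqo eqr.
  by rewrite eq12 eqr; apply: D_right_excluded.
(* [agree] wants its second state to be a pair, so the roles are swapped when only [q] is one. *)
case E': q' => [r|]; first by rewrite -E'; apply: agree E'.
case E: q => [r|] //; rewrite -E -E'; apply/esym.
by apply: (agree q' q _ _ r).
Qed.

(** * Accessibility, finiteness and determinism of the automaton *)

Lemma D_accessible q : exists w, reach _ D None w q.
Proof.
case: q => [r|]; last by exists [::]; apply/reach_nil.
have [_ [e [Ee le te]]] := set_valP r.
have [p1 [p2 [pth1 _ red]]] := core_edgeP _ _ _ Ee.
(* Cutting the closed path just after [e] makes the run end at [terminus e] with last letter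
   [label e], which is the position of [r]. *)
have pth : dpath (core_edges H) (D_position None).1 (rcons p1 e) (terminus e).
  by rewrite -cats1; apply/dpath_cat; exists (origin e).
have red1 : reduced (map (@label _ _) (rcons p1 e)).
  apply/forallP => x; apply: contra (forallP red x) => /infix_catr inf.
  by rewrite -cat_rcons map_cat; apply: inf.
have [q' rq' pos] := D_run None _ _ pth red1.
exists (map (@label _ _) (rcons p1 e)); suff <- : q' = Some r by [].
apply: D_position_inj; rewrite pos -cats1 foldl_cat /=.
by rewrite /position_step le te.
Qed.

Lemma D_finite : finitely_generated H -> finite_set [set: state D].
Proof.
move=> [S finS HS].
pose B := generator_vertices _ H S `*` [set: option (letter m)].
apply: (@sub_finite_set _ _ (D_position @^-1` B)); last first.
  apply: finite_preimage; first by move=> q q' _ _; exact: D_position_inj.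
  by apply: finite_setX => //; apply: finite_generator_vertices.
move=> q _; split=> //; case: q => [r|] /=; last by left.
have [_ [e [Ee _ <-]]] := set_valP r.
by have [] := core_edges_generator_vertices _ _ Hgrp _ _ HS Ee.
Qed.

Lemma D_dfa : finitely_generated H -> is_dfa D.
Proof.
move=> fg; split; first exact: D_finite; first by exists None.
move=> [[q x] q1] [[q' x'] q2] E1 E2 eqq eqx.
rewrite /origin /label /= in eqq eqx; rewrite -eqq -eqx in E2 *.
suff -> : q1 = q2 by []; apply: D_position_inj.
(* The position of the target depends only on the source and the letter read. *)
have step q3 : D_trans q x q3 ->
    D_position q3 = (right_coset (D_position q).1 (fletter x), Some x).
  move=> tr; have /D_reach_vertex eqv : reach _ D q [:: x] q3.
    by apply/reach_cons; exists q3 => //; apply/reach_nil.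
  rewrite [LHS]surjective_pairing eqv freeword_cons freeword_nil mulg1.
  by congr (_, _); case: q q3 tr {eqv E1 E2 eqq} => [r|] [s|] //=;
    [case=> _ _ -> | case=> _ ->].
by rewrite (step _ E1) (step _ E2).
Qed.

End DAutomaton.

Theorem theorem5p8 (m : nat) (H : set (freegroup m)) :
  is_subgroup H -> finitely_generated H -> H <> [set 1] ->
  is_minimal_dfa (D_automaton H).
Proof.
move=> Hgrp fg _; apply: (@minimal_dfa_criterion _ (D_automaton H) None) => //.
- exact: D_dfa.
- exact: D_accessible.
- exact: D_right_nonempty.
- exact: D_right_inj.
Qed.
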